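(* The geometry of the lines and planes of the affine semipolar space $\langle Y,\mathcal{G}\rangle$ which pass through the point $[\mathbf{0},\theta]$ is isomorphic to $\mathbf{Q}(\eta,V)$. That is, the incidence structure whose points are the lines $L\in\mathcal{G}$ through $[\mathbf{0},\theta]$ and whose lines are the planes of $\langle Y,\mathcal{G}\rangle$ through $[\mathbf{0},\theta]$, with inclusion as incidence, is isomorphic to $\mathbf{Q}(\eta,V)$.
   Context: Let $F$ be a commutative field with $\mathrm{char}(F)\neq 2$; let $V,V'$ be vector spaces over $F$ with zero vectors $\theta$ and $\mathbf{0}$, $\dim V'<\infty$; let $\eta\colon V\times V\to V'$ be an alternating bilinear map ($\eta(u,u)=\mathbf{0}$ for all $u$) that is nondegenerate (for each $u_1\ne\theta$ there is $u_2$ with $\eta(u_1,u_2)\neq\mathbf{0}$). Let $Y=V'\oplus V$, with vectors written $[v,u]$, $v\in V'$, $u\in V$, and let $\mathfrak{A}$ be the affine space over $Y$ (points are the vectors of $Y$, lines are the cosets of 1-dimensional subspaces). The semiform is $\varrho([v_1,u_1],[v_2,u_2])=\eta(u_1,u_2)-(v_1-v_2)$. Write $p_1\approx p_2$ iff $\varrho(p_1,p_2)=\mathbf{0}$. Let $\mathcal{G}$ be the class of lines $L$ of $\mathfrak{A}$ such that $p_1\approx p_2$ for all $p_1,p_2\in L$ (equivalently, for some pair of distinct points of $L$). The incidence structure $\langle Y,\mathcal{G}\rangle$ is the affine semipolar space determined by $\varrho$. A plane of $\langle Y,\mathcal{G}\rangle$ is a 2-dimensional affine subspace of $\mathfrak{A}$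 any two points of which are in the relation $\approx$ (a singular plane). The structure $\mathbf{Q}(\eta,V)$ has as points all 1-dimensional subspaces of $V$ and as lines the 2-dimensional subspaces $\langle u',u''\rangle$ of $V$ with $u',u''$ linearly independent and $\eta(u',u'')=\mathbf{0}$; incidence is inclusion. *)

(* Defs.v *)
From mathcomp Require Import all_boot all_order all_algebra.
From mathcomp Require Import classical_sets.

Set Implicit Arguments.
Unset Strict Implicit.
Unset Printing Implicit Defensive.

Import GRing.Theory.

Local Open Scope ring_scope.
Local Open Scope classical_set_scope.

Record incidence_structure := IncidenceStructure {
  inc_point : Type;
  inc_line : Type;
  incident : inc_point -> inc_line -> Prop }.

Definition inc_isomorphic (S T : incidence_structure) : Prop :=
  exists (f : inc_point S -> inc_point T) (g : inc_line S -> inc_line T),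
    [/\ bijective f, bijective g &
        forall p l, incident p l <-> incident (f p) (g l)].

Definition inclusion_structure (T : Type) (P L : set (set T)) :
    incidence_structure :=
  @IncidenceStructure {A : set T | P A} {B : set T | L B}
    (fun A B => sval A `<=` sval B).

(* The notions of vector.v ({vspace W}, free, \dim) require W to be finite
   dimensional; here W is arbitrary and its subspaces are sets of vectors. *)
Section Subspaces.
Variables (F : fieldType) (W : lmodType F).

Definition lin_indep n (e : n.-tuple W) : Prop :=
  forall c : 'I_n -> F, \sum_(i < n) c i *: tnth e i = 0 -> forall i, c i = 0.

Definition lin_span n (e : n.-tuple W) : set W :=
  [set w | exists c : 'I_n -> F, w = \sum_(i < n) c i *: tnth e i].

Definition is_subspace n (U : set W) : Prop :=
  exists e : n.-tuple W, lin_indep e /\ U = lin_span e.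

Definition is_affine_subspace n (A : set W) : Prop :=
  exists (p : W) (U : set W), is_subspace n U /\ A = [set p + w | w in U].

End Subspaces.

Section Semipolar.
Variables (F : fieldType) (V' : vectType F) (V : lmodType F).
Variable eta : {bilinear V -> V -> V'}.

Definition alternating_map : Prop := forall u, eta u u = 0.

Definition nondegenerate_map : Prop :=
  forall u1, u1 != 0 -> exists u2, eta u1 u2 != 0.

Local Notation Y := (V' * V)%type.

Definition semiform (p1 p2 : Y) : V' := eta p1.2 p2.2 - (p1.1 - p2.1).

Definition adjacent (p1 p2 : Y) : Prop := semiform p1 p2 = 0.

Definition singular (A : set Y) : Prop :=
  forall p1 p2, A p1 -> A p2 -> adjacent p1 p2.

Definition semipolar_line (L : set Y) : Prop :=
  is_affine_subspace 1 L /\ singular L.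

Definition semipolar_plane (A : set Y) : Prop :=
  is_affine_subspace 2 A /\ singular A.

Definition lines_planes_through (p : Y) : incidence_structure :=
  inclusion_structure [set L | semipolar_line L /\ L p]
                      [set A | semipolar_plane A /\ A p].

Definition Q_line (U : set V) : Prop :=
  exists u' u'' : V, [/\ lin_indep [tuple u'; u''], eta u' u'' = 0 &
                         U = lin_span [tuple u'; u'']].

Definition Q_structure : incidence_structure :=
  inclusion_structure (is_subspace 1) Q_line.

End Semipolar.

(* Main.v *)
Require Import Defs.
From HB Require Import structures.
From mathcomp Require Import all_boot all_order all_algebra.
From mathcomp Require Import boolp classical_sets.

Set Implicit Arguments.
Unset Strict Implicit.

Import GRing.Theory.

Local Open Scope ring_scope.

(** A point [(v, u)] is adjacent to the origin iff [v = 0], and two points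
    [(0, u1)], [(0, u2)] are adjacent iff [eta u1 u2 = 0].  Hence the singular
    affine subspaces through the origin are exactly the images, under
    [u |-> (0, u)], of the totally isotropic linear subspaces of [V], and a
    subspace spanned by [u] (resp. by [u', u'']) is totally isotropic always
    (resp. iff [eta u' u'' = 0]), because [eta] is alternating. *)

Local Open Scope classical_set_scope.

Section LinearSpan.
Variables (F : fieldType) (W : lmodType F) (n : nat).
Implicit Types (e : n.-tuple W) (U A : set W).

Lemma lin_span_tnth e i : lin_span e (tnth e i).
Proof.
exists (fun j => (j == i)%:R).
rewrite (bigD1 i) //= eqxx scale1r big1 ?addr0 // => j /negPf ->.
by rewrite scale0r.
Qed.

Lemma lin_span0 e : lin_span e 0.
Proof. by exists (fun=> 0); rewrite big1 // => i _; rewrite scale0r. Qed.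

Lemma lin_spanD e x y : lin_span e x -> lin_span e y -> lin_span e (x + y).
Proof.
move=> [c ->] [d ->]; exists (fun i => c i + d i).
by rewrite -big_split; apply: eq_bigr => i _; rewrite scalerDl.
Qed.

Lemma lin_spanN e x : lin_span e x -> lin_span e (- x).
Proof.
move=> [c ->]; exists (fun i => - c i).
by rewrite -sumrN; apply: eq_bigr => i _; rewrite scaleNr.
Qed.

(** If the coset [p + U] contains [0 = p + w0] with [w0] in [U], then [p = - w0] lies in [U] and
    translation by it maps [U] onto itself. *)
Lemma affine_subspace_through0 A :
  is_affine_subspace n A /\ A 0 <-> is_subspace n A.
Proof.
split=> [[[p [U [[e [e_free ->]] ->]]] [w0 w0e /eqP pw0]]|[e [e_free ->]]].
- exists e; split=> //.
  move: pw0; rewrite addr_eq0 => /eqP ->.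
  apply/seteqP; split=> [_ [w we <-]|w we].
    by apply: lin_spanD => //; apply: lin_spanN.
  by exists (w + w0); [apply: lin_spanD | rewrite addrCA addNr addr0].
- split; last exact: lin_span0.
  exists 0, (lin_span e); split; first by exists e.
  (* The span is written as its own image under the identity, so that two images of one set are
     compared pointwise. *)
  by rewrite -[LHS]image_id; apply: eq_imagel => w _; rewrite add0r.
Qed.

End LinearSpan.

Section InjectiveImage.
Variables (F : fieldType) (V W : lmodType F) (j : {linear V -> W}) (n : nat).
Hypothesis j_inj : injective j.
Implicit Types (e : n.-tuple V) (U : set V).

Lemma linear_comb_map_tuple e (c : 'I_n -> F) :
  \sum_(i < n) c i *: tnth (map_tuple j e) i =
  j (\sum_(i < n) c i *: tnth e i).
Proof.
by rewrite linear_sum; apply: eq_bigr => i _; rewrite tnth_map linearZ.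
Qed.

Lemma lin_span_map e : lin_span (map_tuple j e) = j @` lin_span e.
Proof.
apply/seteqP; split=> [_ [c ->]|_ [_ [c ->] <-]].
- by rewrite linear_comb_map_tuple; eexists; first by exists c.
- by exists c; rewrite linear_comb_map_tuple.
Qed.

Lemma lin_indep_map e : lin_indep (map_tuple j e) <-> lin_indep e.
Proof.
split=> e_free c.
- by move=> ce0; apply: e_free; rewrite linear_comb_map_tuple ce0 linear0.
- rewrite linear_comb_map_tuple -(linear0 j) => /j_inj; exact: e_free.
Qed.

(** For the direct implication, each vector of a basis of the image is lifted through [j] by choice;
    injectivity of [j] then allows the span of the lifts to be compared with [U] inside [W]. *)
Lemma is_subspace_image U : is_subspace n (j @` U) <-> is_subspace n U.
Proof.
split=> [[e [e_free jU]]|[e [e_free ->]]]; last first.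
  exists (map_tuple j e).
  by split; [exact/lin_indep_map | rewrite lin_span_map].
have /choice[h hP] i : exists u, j u = tnth e i.
  have : (j @` U) (tnth e i) by rewrite jU; apply: lin_span_tnth.
  by case=> u _ <-; exists u.
have eE : e = map_tuple j [tuple h i | i < n].
  by apply: eq_from_tnth => i; rewrite tnth_map tnth_mktuple hP.
rewrite eE in e_free jU.
exists [tuple h i | i < n]; split; first exact/lin_indep_map.
move: jU; rewrite lin_span_map => jU.
apply/seteqP; split=> u uU.
- have : (j @` U) (j u) by exists u.
  by rewrite jU => -[v vh /j_inj <-].
- have : (j @` lin_span [tuple h i | i < n]) (j u) by exists u.
  by rewrite -jU => -[v vh /j_inj <-].
Qed.

End InjectiveImage.

Section VerticalEmbedding.
Variables (F : fieldType) (V' V : lmodType F).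

Definition vertical (u : V) : V' * V := (0, u).

Lemma vertical_is_linear : linear vertical.
Proof. by move=> a u v; congr pair; rewrite /= scaler0 addr0. Qed.

HB.instance Definition _ :=
  GRing.isLinear.Build F V (V' * V)%type *:%R vertical vertical_is_linear.

Lemma vertical_inj : injective vertical.
Proof. by move=> u v []. Qed.

End VerticalEmbedding.

Section Singular.
Variables (F : fieldType) (V' : vectType F) (V : lmodType F).
Variable eta : {bilinear V -> V -> V'}.
Local Notation j := (@vertical F V' V).

Definition isotropic (U : set V) : Prop :=
  forall u1 u2, U u1 -> U u2 -> eta u1 u2 = 0.

Lemma singular_vertical (U : set V) : singular eta (j @` U) <-> isotropic U.
Proof.
split=> [sU u1 u2 U1 U2|iU _ _ [u1 U1 <-] [u2 U2 <-]].
- have : adjacent eta (j u1) (j u2) by apply: sU; [exists u1 | exists u2].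
  by rewrite /adjacent /semiform /= !subr0.
- by rewrite /adjacent /semiform /= !subr0; apply: iU.
Qed.

Lemma singular_through0_vertical (A : set (V' * V)) :
  singular eta A -> A 0 -> j @` (j @^-1` A) = A.
Proof.
move=> sA A0; apply/seteqP; split=> [_ [u Au <-] //|[v u] Avu].
have := sA _ _ Avu A0.
rewrite /adjacent /semiform /= linear0 subr0 sub0r => /eqP.
by rewrite oppr_eq0 => /eqP v0; exists u; rewrite /= /vertical -?v0.
Qed.

Lemma lin_span_isotropic n (e : n.-tuple V) :
  (forall i k, eta (tnth e i) (tnth e k) = 0) -> isotropic (lin_span e).
Proof.
move=> e0 _ _ [c ->] [d ->].
rewrite linear_sumlz big1 // => i _; rewrite linearZl_LR linear_sumr.
by rewrite big1 ?scaler0 // => k _; rewrite linearZr_LR /= e0 scaler0.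
Qed.

(** Keeping [n] free serves both halves of the isomorphism: at [n = 1] and [n = 2] the left side
    unfolds to being a semipolar line, respectively plane, through the origin. *)
Lemma singular_subspace_vertical n (U : set V) :
  (is_affine_subspace n (j @` U) /\ singular eta (j @` U)) /\ (j @` U) 0 <->
  is_subspace n U /\ isotropic U.
Proof.
rewrite -singular_vertical -(is_subspace_image n (@vertical_inj F V' V)).
rewrite -affine_subspace_through0; tauto.
Qed.

Hypothesis eta_alt : alternating_map eta.

(** Polarization: expanding [eta (u + v) (u + v) = 0] leaves [eta u v + eta v u = 0]. *)
Lemma alternating_swap u v : eta u v = 0 -> eta v u = 0.
Proof.
move=> uv0; have := eta_alt (u + v).
by rewrite linearDl !linearDr /= !eta_alt uv0 !addr0 !add0r.
Qed.

Lemma subspace1_isotropic (U : set V) : is_subspace 1 U -> isotropic U.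
Proof.
move=> [e [_ ->]]; apply: lin_span_isotropic => i k.
by rewrite !ord1 eta_alt.
Qed.

Lemma Q_lineP (U : set V) : Q_line eta U <-> is_subspace 2 U /\ isotropic U.
Proof.
split=> [[u [v [uv_free uv0 ->]]]|[[e [e_free ->]] iU]].
- split; first by exists [tuple u; v].
  apply: lin_span_isotropic => i k; rewrite !(tnth_nth 0).
  case: i k => [[|[|//]] ?] [[|[|//]] ?] /=; rewrite ?eta_alt //.
  exact: alternating_swap.
(* [Q_line] asks for a literal pair, so the basis is rebuilt from its two entries; in ['I_2],
   [ord_max] is the index 1. *)
- have eE : e = [tuple tnth e ord0; tnth e ord_max].
    apply: eq_from_tnth => i; rewrite [RHS](tnth_nth 0).
    by case: i => [[|[|//]] ?]; congr tnth; apply: val_inj.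
  exists (tnth e ord0), (tnth e ord_max); rewrite -eE; split=> //.
  by apply: iU; apply: lin_span_tnth.
Qed.

End Singular.

Section InclusionIsomorphism.
Variables (V Y : Type) (j : V -> Y).
Hypothesis j_inj : injective j.

Lemma preimage_image_inj (U : set V) : j @^-1` (j @` U) = U.
Proof.
apply/seteqP; split=> u; first by case=> v Uv /j_inj <-.
by exists u.
Qed.

(** The inverse is direct image along [j]. Elements of the subtypes are equal as soon as their
    underlying sets are, by proof irrelevance. *)
Lemma bijective_preimage (P : set (set Y)) (P' : set (set V))
    (fP : forall A, P A -> P' (j @^-1` A)) :
    (forall A, P A -> j @` (j @^-1` A) = A) ->
    (forall U, P' U -> P (j @` U)) ->
  bijective (fun A : {A | P A} => exist P' _ (fP _ (svalP A))).
Proof.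
move=> PK P'P.
exists (fun U => exist P _ (P'P _ (svalP U))) => [[A PA]|[U PU]];
  apply: eq_exist; [exact: PK | exact: preimage_image_inj].
Qed.

(** Preimage along [j] acts on points and lines alike. It preserves inclusion by monotonicity, and
    reflects it because each set is recovered as the image of its preimage. *)
Lemma inclusion_structure_iso (P L : set (set Y)) (P' L' : set (set V)) :
    (forall A, P A -> j @` (j @^-1` A) = A) ->
    (forall A, L A -> j @` (j @^-1` A) = A) ->
    (forall U, P (j @` U) <-> P' U) -> (forall U, L (j @` U) <-> L' U) ->
  inc_isomorphic (inclusion_structure P L) (inclusion_structure P' L').
Proof.
move=> PK LK PP' LL'.
have fP A : P A -> P' (j @^-1` A) by move=> PA; apply/PP'; rewrite PK.
have gP A : L A -> L' (j @^-1` A) by move=> LA; apply/LL'; rewrite LK.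
exists (fun A : {A | P A} => exist P' _ (fP _ (svalP A))).
exists (fun A : {A | L A} => exist L' _ (gP _ (svalP A))).
split=> [||[A PA] [B LB]] /=.
- by apply: bijective_preimage => // U /PP'.
- by apply: bijective_preimage => // U /LL'.
- split=> [AB u /AB //|AB].
  by rewrite -(PK _ PA) -(LK _ LB); apply: image_subset.
Qed.

End InclusionIsomorphism.

Local Close Scope classical_set_scope.
Unset Implicit Arguments.
Set Strict Implicit.

Theorem proposition2p26 (F : fieldType) (hF : 2%N \notin [pchar F])
    (V' : vectType F) (V : lmodType F) (eta : {bilinear V -> V -> V'})
    (eta_alt : alternating_map eta) (eta_nondeg : nondegenerate_map eta) :
  inc_isomorphic (lines_planes_through eta (0, 0)) (Q_structure eta).
Proof.
apply: (@inclusion_structure_iso _ _ (@vertical F V' V)).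
- exact: vertical_inj.
- by move=> A [[_ sA] A0]; apply: singular_through0_vertical sA A0.
- by move=> A [[_ sA] A0]; apply: singular_through0_vertical sA A0.
(* For points isotropy is automatic; for lines it is the condition that [Q_lineP] matches with
   [Q_line]. *)
- move=> U; apply: iff_trans (singular_subspace_vertical eta 1 U) _.
  split=> [[]|U1] //; split=> //; exact: subspace1_isotropic.
- move=> U; apply: iff_trans (singular_subspace_vertical eta 2 U) _.
  exact: iff_sym (Q_lineP eta_alt U).
Qed.
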